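(* Let $\mathcal{T}=(V,E)$ be a countably infinite rooted and leafless directed tree and let $\boldsymbol{\mu}=\{\mu_v\}_{v\in V^\circ}$ be a family of nonzero complex numbers. Let $\boldsymbol{\lambda}=\{\lambda_v\}_{v\in V^\circ}\subseteq(0,\infty)$. Define the family $\boldsymbol\beta=\{\beta_v\}_{v\in V}\subseteq(0,\infty)$ by $$\beta_v=\left|\frac{\mu_{\mathrm{root}|v}}{\lambda_{\mathrm{root}|v}}\right|^2,\quad v\in V.$$ Then the operator $U:\ell^2(V,\mathbf{1})\to\ell^2(V,\boldsymbol\beta)$ defined by $$(Uf)(u)=\frac{\lambda_{\mathrm{root}|u}}{\mu_{\mathrm{root}|u}}\,f(u),\quad u\in V,\ f\in\ell^2(V,\mathbf{1}),$$ is unitary and the weighted shift $S_{\boldsymbol\mu}$ on $\mathcal{T}_{\mathbf{1}}$ is unitarily equivalent to the weighted shift $S_{\boldsymbol\lambda}$ on $\mathcal{T}_{\boldsymbol\beta}$ via $U$, i.e., $US_{\boldsymbol\mu}=S_{\boldsymbol\lambda}U$ (equality of possibly unbounded operators, including equality of domains).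
   Context: $\mathbb{N}_0=\{0,1,2,\dots\}$. A rooted directed tree $\mathcal{T}=(V,E)$ is a connected directed graph without circuits having a unique vertex $\mathrm{root}$ without a parent and such that every $v\in V^\circ:=V\setminus\{\mathrm{root}\}$ has a unique parent $\mathrm{par}(v)$, i.e. a unique $u$ with $(u,v)\in E$. $\mathrm{par}^k$ is the $k$-fold composition of $\mathrm{par}$ ($\mathrm{par}^0$ the identity); leafless means every vertex has at least one child; $|v|$ is the unique $k\in\mathbb{N}_0$ with $\mathrm{par}^k(v)=\mathrm{root}$. Put $\lambda_{\mathrm{root}|v}=\prod_{j=0}^{|v|-1}\lambda_{\mathrm{par}^j(v)}$ (equal to $1$ if $v=\mathrm{root}$), and similarly $\mu_{\mathrm{root}|v}$. For a family $\boldsymbol\beta=\{\beta_v\}_{v\in V}\subseteq(0,\infty)$, $\ell^2(V,\boldsymbol{\beta})$ is the Hilbert space of all $f:V\to\mathbb{C}$ with $\sum_{v\in V}|f(v)|^2\beta_v<\infty$, with $\langle f,g\rangle_{\boldsymbol\beta}=\sum_{v\in V} f(v)\overline{g(v)}\beta_v$; $\mathbf{1}$ is the constant family with all entries $1$; $\mathcal{T}_{\boldsymbol\beta}$ denotes the pair $(\mathcal{T},\boldsymbol\beta)$. For complex weights $\boldsymbol\lambda=\{\lambda_v\}_{v\in V^\circ}$, the weighted shift $S_{\boldsymbol{\lambda}}$ on $\mathcal{T}_{\boldsymbol\beta}$ is the operator in $\ell^2(V,\boldsymbol\beta)$ given by $(S_{\boldsymbol\lambda}f)(v)=\lambda_v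 f(\mathrm{par}(v))$ for $v\in V^\circ$, $(S_{\boldsymbol\lambda}f)(\mathrm{root})=0$, on the domain of all $f\in\ell^2(V,\boldsymbol\beta)$ for which the resulting function lies in $\ell^2(V,\boldsymbol\beta)$. *)

(* Defs.v *)
From HB Require Import structures.
From mathcomp Require Import all_boot all_order all_algebra finmap.
From mathcomp Require Export complex.
From mathcomp Require Import ring lra.
From mathcomp Require Import boolp classical_sets functions cardinality fsbigop reals ereal.
From mathcomp Require Import topology normedtype esum.

Set Implicit Arguments.
Unset Strict Implicit.
Unset Printing Implicit Defensive.

Import Order.TTheory GRing.Theory Num.Theory.

Local Open Scope classical_set_scope.
Local Open Scope ring_scope.
Local Open Scope complex_scope.

Definition graph_connected (V : choiceType) (E : rel V) : Prop :=
  forall u v, exists p : seq V,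
    path (fun x y => E x y || E y x) u p /\ last u p = v.

(* A circuit is a nonempty sequence of distinct vertices, each joined to the
   next and the last to the first; length one excludes loops. *)
Definition no_circuit (V : choiceType) (E : rel V) : Prop :=
  forall c : seq V, c != [::] -> uniq c -> ~~ cycle E c.

Record rooted_tree (V : choiceType) (E : rel V) (root : V) : Prop := {
  tree_connected : graph_connected E;
  tree_no_circuit : no_circuit E;
  tree_root : forall v, (forall u, ~~ E u v) <-> v = root;
  tree_parent : forall v, v != root -> exists! u, E u v }.

Definition leafless (V : choiceType) (E : rel V) : Prop :=
  forall u, exists v, E u v.

(* Meaningful only at vertices other than the root; the value at the root is
   the root itself, and no definition below depends on it. *)
Definition par (V : choiceType) (E : rel V) (v : V) : V :=
  xget v [set u | E u v].

(* |v|. The second clause says that v lies in the domain of the k-th power of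
   par seen as a partial map, undefined at the root. *)
Definition depth (V : choiceType) (E : rel V) (root v : V) : nat :=
  xget 0%N [set k | iter k (par E) v = root /\
                    forall j, (j < k)%N -> iter j (par E) v <> root].

(* Families indexed by the non-root vertices are total functions on V whose
   value at the root is never used. *)
Definition path_prod (K : comPzRingType) (V : choiceType) (E : rel V)
    (root : V) (w : V -> K) (v : V) : K :=
  \prod_(0 <= j < depth E root v) w (iter j (par E) v).

Definition l2 (R : realType) (V : choiceType) (beta : V -> R) :
    set (V -> R[i]) :=
  [set f | (\esum_(v in [set: V])
              (Normc.normc (f v) ^+ 2 * beta v)%:E < +oo)%E].

Definition has_sum (R : realType) (V : choiceType) (x : V -> R[i])
    (s : R[i]) : Prop :=
  forall e : R, 0 < e -> exists A0 : {fset V}, forall A : {fset V},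
    (A0 `<=` A)%fset -> Normc.normc (\sum_(v <- A) x v - s) < e.

(* Sums over V of complex families are unordered sums; the default 0 is not
   used for positive beta and f, g in l2 (see l2_innerP). *)
Definition l2_inner (R : realType) (V : choiceType) (beta : V -> R)
    (f g : V -> R[i]) : R[i] :=
  xget 0 [set s | has_sum (fun v => f v * (g v)^* * (beta v)%:C) s].

Lemma Normc_ge0 (R : realType) (z : R[i]) : 0 <= Normc.normc z.
Proof. by case: z => a b; exact: sqrtr_ge0. Qed.

Lemma normcJR (R : realType) (z : R[i]) : Normc.normc z^* = Normc.normc z.
Proof. by case: z => a b; rewrite /= sqrrN. Qed.

Lemma normc_real (R : realType) (x : R) : 0 <= x -> Normc.normc x%:C = x.
Proof. by move=> x0; rewrite /= expr0n addr0 sqrtr_sqr ger0_norm. Qed.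

Lemma normc_ge_ReR (R : realType) (z : R[i]) :
  `|complex.Re z| <= Normc.normc z.
Proof. by case: z => a b; rewrite /= -sqrtr_sqr ler_wsqrtr// lerDl sqr_ge0. Qed.

Lemma normc_ge_ImR (R : realType) (z : R[i]) :
  `|complex.Im z| <= Normc.normc z.
Proof. by case: z => a b; rewrite /= -sqrtr_sqr ler_wsqrtr// lerDr sqr_ge0. Qed.

Lemma normc_le_ReIm (R : realType) (z : R[i]) :
  Normc.normc z <= `|complex.Re z| + `|complex.Im z|.
Proof.
case: z => a b /=; rewrite -[leRHS]ger0_norm ?addr_ge0// -sqrtr_sqr.
rewrite ler_wsqrtr// sqrrD !real_normK ?num_real//.
by rewrite lerD2r lerDl mulrn_wge0// mulr_ge0.
Qed.

Lemma has_sum_uniq (R : realType) (V : choiceType) (x : V -> R[i]) s t :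
  has_sum x s -> has_sum x t -> s = t.
Proof.
move=> xs xt; apply/subr0_eq/Normc.eq0_normc/eqP.
rewrite eq_le Normc_ge0 andbT leNgt; apply/negP => d0.
have d20 : 0 < Normc.normc (s - t) / 2 by rewrite divr_gt0.
have [A0 sA] := xs _ d20; have [B0 tB] := xt _ d20.
have := ltrD (sA _ (fsubsetUl A0 B0)) (tB _ (fsubsetUr A0 B0)).
rewrite -splitr ltNge => /negP; apply.
rewrite -(normcN (_ - s)) opprB; set z := \sum_(_ <- _) _.
by rewrite (_ : s - t = s - z + (z - t)) ?le_normcD// addrA subrK.
Qed.

Lemma nneg_sum_cvg (R : realType) (V : choiceType) (a : V -> R) (B : R) :
  (forall v, 0 <= a v) ->
  (forall A : {fset V}, \sum_(v <- A) a v <= B) ->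
  exists s, forall e : R, 0 < e -> exists A0 : {fset V}, forall A : {fset V},
    (A0 `<=` A)%fset -> `|\sum_(v <- A) a v - s| < e.
Proof.
move=> a0 aB; pose S := [set \sum_(v <- A) a v | A in [set: {fset V}]].
have supS : has_sup S.
  by split; [exists (\sum_(v <- fset0) a v), fset0|exists B => _ [A _ <-]].
exists (sup S) => e e0.
have [_ [A0 _ <-] A0e] := sup_adherent e0 supS.
exists A0 => A A0A.
have AS : \sum_(v <- A) a v <= sup S by apply: sup_upper_bound => //; exists A.
have A0S : \sum_(v <- A0) a v <= \sum_(v <- A) a v.
  rewrite [leRHS](big_fsetID _ (mem A0))/= -[leLHS]addr0 lerD ?sumr_ge0//.
  rewrite le_eqVlt; apply/orP; left; apply/eqP.
  apply: eq_fbigl => v; rewrite !inE/=.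
  by case: (boolP (v \in A0)) => [/(fsubsetP A0A)->|]; rewrite ?andbF.
by rewrite ler0_norm ?subr_le0// opprB ltrBlDl -ltrBlDr (lt_le_trans A0e).
Qed.

Lemma dominated_sum_cvg (R : realType) (V : choiceType) (a m : V -> R) (B : R) :
  (forall v, `|a v| <= m v) ->
  (forall A : {fset V}, \sum_(v <- A) m v <= B) ->
  exists s, forall e : R, 0 < e -> exists A0 : {fset V}, forall A : {fset V},
    (A0 `<=` A)%fset -> `|\sum_(v <- A) a v - s| < e.
Proof.
move=> am mB.
have m0 v : 0 <= m v by rewrite (le_trans _ (am v)).
have [s ms] := nneg_sum_cvg m0 mB.
have am0 v : 0 <= a v + m v.
  by rewrite -lerBlDr sub0r; have := am v; rewrite ler_norml => /andP[].
have amB (A : {fset V}) : \sum_(v <- A) (a v + m v) <= B + B.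
  rewrite big_split lerD//= (le_trans _ (mB A))// ler_sum// => v _.
  exact: le_trans (ler_norm _) (am v).
have [t ts] := nneg_sum_cvg am0 amB.
exists (t - s) => e e0.
have e20 : 0 < e / 2 by rewrite divr_gt0.
have [A0 mA] := ms _ e20; have [B0 tB] := ts _ e20.
exists (A0 `|` B0)%fset => A; rewrite fsubUset => /andP[A0A B0A].
have := ltrD (tB _ B0A) (mA _ A0A); rewrite -splitr; apply: le_lt_trans.
apply: le_trans (ler_normB _ _); rewrite big_split/=.
by rewrite le_eqVlt; apply/orP; left; apply/eqP; congr `|_|; ring.
Qed.

Lemma l2_bounded (R : realType) (V : choiceType) (beta : V -> R)
    (f : V -> R[i]) : (forall v, 0 < beta v) -> l2 beta f ->
  exists B, forall A : {fset V},
    \sum_(v <- A) Normc.normc (f v) ^+ 2 * beta v <= B.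
Proof.
move=> b0 f2; set h := fun v => Normc.normc (f v) ^+ 2 * beta v.
have h0 v : 0 <= h v by rewrite mulr_ge0 ?sqr_ge0// ltW.
have S0 : (0 <= \esum_(v in [set: V]) (h v)%:E)%E.
  by apply: esum_ge0 => v _; rewrite lee_fin.
exists (fine (\esum_(v in [set: V]) (h v)%:E)) => A.
rewrite -lee_fin fineK ?ge0_fin_numE//.
apply: esum_ge; exists [set` A]; first by split.
by rewrite fsbig_finite//= set_fsetK sumEFin.
Qed.

Lemma l2_innerP (R : realType) (V : choiceType) (beta : V -> R)
    (f g : V -> R[i]) :
  (forall v, 0 < beta v) -> l2 beta f -> l2 beta g ->
  has_sum (fun v => f v * (g v)^* * (beta v)%:C) (l2_inner beta f g).
Proof.
move=> b0 /(l2_bounded b0)[B fB] /(l2_bounded b0)[D gD].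
set x := fun v => _; rewrite /l2_inner -/x.
suff: exists s, has_sum x s by exact: (@xgetPex _ _ [set s | has_sum x s]).
pose m v := Normc.normc (f v) ^+ 2 * beta v + Normc.normc (g v) ^+ 2 * beta v.
have mBD (A : {fset V}) : \sum_(v <- A) m v <= B + D.
  by rewrite big_split lerD//=.
have xm v : Normc.normc (x v) <= m v.
  rewrite /x /m !Normc.normcM -mulrDl normcJR normc_real ?(ltW (b0 v))//.
  rewrite ler_wpM2r ?(ltW (b0 v))//.
  have := Normc_ge0 (f v); have := Normc_ge0 (g v).
  move: (Normc.normc _) (Normc.normc _) => p q p0 q0; nra.
have rem v : `|complex.Re (x v)| <= m v := le_trans (normc_ge_ReR _) (xm v).
have imm v : `|complex.Im (x v)| <= m v := le_trans (normc_ge_ImR _) (xm v).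
have [s xs] := dominated_sum_cvg rem mBD.
have [t xt] := dominated_sum_cvg imm mBD.
exists (s +i* t) => e e0.
have e20 : 0 < e / 2 by rewrite divr_gt0.
have [A0 sA] := xs _ e20; have [B0 tB] := xt _ e20.
exists (A0 `|` B0)%fset => A; rewrite fsubUset => /andP[A0A B0A].
have := ltrD (sA _ A0A) (tB _ B0A); rewrite -splitr; apply: le_lt_trans.
apply: le_trans (normc_le_ReIm _) _.
by rewrite !raddfB !raddf_sum.
Qed.

(* An operator with its domain; [op_fun] is only relevant on [op_dom]. *)
Record operator (R : realType) (V : choiceType) := Operator {
  op_dom : set (V -> R[i]);
  op_fun : (V -> R[i]) -> V -> R[i] }.

Definition op_comp (R : realType) (V : choiceType) (A B : operator R V) :
    operator R V :=
  Operator [set f | op_dom B f /\ op_dom A (op_fun B f)]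
           (fun f => op_fun A (op_fun B f)).

Definition op_eq (R : realType) (V : choiceType) (A B : operator R V) : Prop :=
  op_dom A = op_dom B /\ forall f, op_dom A f -> op_fun A f = op_fun B f.

Definition unitary (R : realType) (V : choiceType) (beta1 beta2 : V -> R)
    (U : operator R V) : Prop :=
  [/\ op_dom U = l2 beta1,
      forall (a : R[i]) f g, l2 beta1 f -> l2 beta1 g ->
        op_fun U (fun v => a * f v + g v)
        = (fun v => a * op_fun U f v + op_fun U g v),
      op_fun U @` l2 beta1 = l2 beta2 &
      forall f g, l2 beta1 f -> l2 beta1 g ->
        l2_inner beta2 (op_fun U f) (op_fun U g) = l2_inner beta1 f g].

Definition wshift (R : realType) (V : choiceType) (E : rel V) (root : V)
    (beta : V -> R) (w : V -> R[i]) : operator R V :=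
  let S f v := if v == root then 0 else w v * f (par E v) in
  Operator [set f | l2 beta f /\ l2 beta (S f)] S.

Definition unit_weight (R : realType) (V : choiceType) : V -> R := fun=> 1.

(* Main.v *)
(** Let c_u = lambda_(root|u) / mu_(root|u), so that U is multiplication by c.
    The weights beta are chosen so that c_u * (c_u)^* * beta_u = 1, hence U
    preserves each summand of the norm and of the inner product.  Since
    lambda_(root|v) = lambda_v * lambda_(root|par v), and likewise for mu,
    c_v * mu_v = lambda_v * c_(par v): the two shifts agree pointwise through U,
    for every function on V, and equality of domains follows because U f
    lies in l^2(V, beta) if and only if f lies in l^2(V, 1). *)

Require Import Defs.
From mathcomp Require Import all_boot all_order all_algebra.
From mathcomp Require Import ring.
From mathcomp Require Import boolp classical_sets cardinality reals ereal esum.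

Set Implicit Arguments.
Unset Strict Implicit.
Unset Printing Implicit Defensive.

Import Order.TTheory GRing.Theory Num.Theory.

Local Open Scope classical_set_scope.
Local Open Scope ring_scope.
Local Open Scope complex_scope.

Section Tree.
Variables (V : choiceType) (E : rel V) (root : V).
Hypothesis treeE : rooted_tree E root.

Lemma root_no_parent u : ~~ E u root.
Proof. by have [_ +] := tree_root treeE root; apply. Qed.

Lemma par_unique u v : E u v -> par E v = u.
Proof.
move=> Euv; have vroot : v != root.
  by apply: contraTneq Euv => ->; exact: root_no_parent.
have [w [_ Ew]] := tree_parent treeE vroot.
rewrite /par -(Ew _ Euv); apply: xget_unique => [|x /= Exv]; last first.
  by rewrite -(Ew _ Exv).
by rewrite /= (Ew _ Euv).
Qed.

(** Follow an undirected path from the root to [v], keeping the root an ancestor of the current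
    vertex: a forward edge raises the exponent by one, a backward edge lowers it by one. *)
Lemma ancestor_root v : exists k, iter k (par E) v = root.
Proof.
have [p [+ <-]] := tree_connected treeE root v.
have : exists k, iter k (par E) root = root by exists 0%N.
(* Only the start of the path is generalized; the root stays fixed as the target of the iterates. *)
elim: p {1 3 4}root => [//|x p IHp] u [k uk] /= /andP[/orP[Eux|Exu]].
  by apply: IHp; exists k.+1; rewrite iterSr (par_unique Eux).
(* Exponent 0 would put the current vertex at the root, from which no backward edge leaves. *)
apply: IHp; case: k uk => [/= uroot|k].
  by move: Exu; rewrite uroot (negbTE (root_no_parent x)).
by rewrite iterSr (par_unique Exu); exists k.
Qed.

Let first_hit v k := iter k (par E) v = root /\
  forall j, (j < k)%N -> iter j (par E) v <> root.

Let first_hit_inj v k l : first_hit v k -> first_hit v l -> k = l.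
Proof.
by move=> [vk mink] [vl minl]; case: (ltngtP k l) => // [/minl|/mink].
Qed.

Let depth_unique v k : first_hit v k -> depth E root v = k.
Proof.
by move=> vk; apply: xget_unique => // l vl; exact: first_hit_inj vl vk.
Qed.

(** The least exponent reaching the root satisfies the predicate that [depth] selects by, so the
    default 0 in [depth] is never a fallback. *)
Let depth_first_hit v : first_hit v (depth E root v).
Proof.
have [k /eqP vk] := ancestor_root v.
have ex : exists k, iter k (par E) v == root by exists k.
suff vm : first_hit v (ex_minn ex) by rewrite (depth_unique vm).
case: ex_minnP => m /eqP vm minm; split=> // j jm /eqP /minm.
by rewrite leqNgt jm.
Qed.

Lemma iter_par_neq_root v j :
  (j < depth E root v)%N -> iter j (par E) v != root.
Proof. by move=> jv; apply/eqP; apply: (depth_first_hit v).2. Qed.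

(** The first hit from [par E v], shifted by one, is the first hit from [v]; the extra index 0 is
    covered by [v != root]. *)
Lemma depth_par v : v != root -> depth E root v = (depth E root (par E v)).+1.
Proof.
move=> vroot; apply: depth_unique; have [pv minpv] := depth_first_hit (par E v).
split=> [|[_|j jv]]; first by rewrite iterSr.
  by apply/eqP.
by rewrite iterSr; apply: minpv.
Qed.

Lemma path_prod_par (K : comPzRingType) (w : V -> K) v : v != root ->
  path_prod E root w v = w v * path_prod E root w (par E v).
Proof.
move=> vroot; rewrite /path_prod (depth_par vroot) big_nat_recl//=.
by congr (_ * _); apply: eq_bigr => j _; rewrite -iterSr.
Qed.

Lemma path_prod_neq0 (K : idomainType) (w : V -> K) :
  (forall v, v != root -> w v != 0) -> forall v, path_prod E root w v != 0.
Proof.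
(* [big_nat] keeps the bound [j < depth E root v], which ensures that [w] is evaluated only off the
   root. *)
move=> w0 v; rewrite /path_prod big_nat prodf_seq_neq0; apply/allP => j _.
by apply/implyP => /andP[_ jv]; exact/w0/iter_par_neq_root.
Qed.

End Tree.

Lemma sqr_normcE (R : realType) (z : R[i]) :
  (Normc.normc z ^+ 2)%:C = z * z^*.
Proof.
case: z => a b; rewrite /= sqr_sqrtr ?addr_ge0 ?sqr_ge0//.
by apply/eqP; rewrite eq_complex/=; apply/andP; split; apply/eqP; ring.
Qed.

Lemma normc_eq0 (R : realType) (z : R[i]) : (Normc.normc z == 0) = (z == 0).
Proof.
by apply/eqP/eqP => [/Normc.eq0_normc//|->]; rewrite Normc.normc0.
Qed.

Section Multiplication.
Variables (R : realType) (V : choiceType) (beta : V -> R) (c : V -> R[i]).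
Hypothesis c_neq0 : forall v, c v != 0.
Hypothesis cbeta : forall v, Normc.normc (c v) ^+ 2 * beta v = 1.

(** By [cbeta] the two series agree term by term, as sums in the extended reals, so membership
    transfers in both directions. *)
Lemma l2_mul f :
  l2 beta (fun v => c v * f v) <-> l2 (@unit_weight R V) f.
Proof.
rewrite /l2 /=.
under eq_esum do rewrite Normc.normcM exprMn mulrAC cbeta mul1r.
by under [X in _ <-> (X < _)%E]eq_esum do rewrite mulr1.
Qed.

Lemma unitary_mul :
  unitary (@unit_weight R V) beta
    (Operator (l2 (@unit_weight R V)) (fun f v => c v * f v)).
Proof.
split=> //= [a f g _ _||f g _ _].
- by apply/funext => v; ring.
- apply/seteqP; split=> [_ [f f2 <-]|g g2]; first exact: (l2_mul f).2 f2.
  have gE : (fun v => c v * ((c v)^-1 * g v)) = g.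
    by apply/funext => v; rewrite mulVKf.
  exists (fun v => (c v)^-1 * g v) => [|]; last exact: gE.
  by apply: (l2_mul _).1; rewrite gE.
(* Equal summands make both inner products the [xget] choice from one and the same set of sums. *)
- have summandE v : c v * f v * (c v * g v)^* * (beta v)%:C =
      f v * (g v)^* * (unit_weight R v)%:C.
    have /(congr1 (fun x : R => x%:C)) := cbeta v.
    rewrite rmorphM/= sqr_normcE rmorph1 => cb.
    rewrite mulr1 -[RHS]mul1r -cb rmorphM/=; ring.
  by rewrite /l2_inner (funext summandE).
Qed.

End Multiplication.

Theorem proposition28 (R : realType) (V : choiceType) (E : rel V) (root : V)
    (V_countable : countable [set: V]) (V_infinite : infinite_set [set: V])
    (treeE : rooted_tree E root) (leaflessE : leafless E)
    (mu : V -> R[i]) (mu_neq0 : forall v, v != root -> mu v != 0)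
    (lambda : V -> R) (lambda_gt0 : forall v, v != root -> 0 < lambda v) :
  let lambda_root := path_prod E root lambda in
  let mu_root := path_prod E root mu in
  let beta := fun v =>
    Normc.normc (mu_root v / (lambda_root v)%:C) ^+ 2 in
  let U := Operator (l2 (@unit_weight R V))
    (fun f u => (lambda_root u)%:C / mu_root u * f u) in
  [/\ forall v, 0 < beta v,
      unitary (@unit_weight R V) beta U &
      op_eq (op_comp U (wshift E root (@unit_weight R V) mu))
            (op_comp (wshift E root beta (fun v => (lambda v)%:C)) U)].
Proof.
move=> lambda_root mu_root beta U.
have lr0 v : lambda_root v != 0.
  by apply: (path_prod_neq0 treeE) => u uroot; rewrite gt_eqF// lambda_gt0.
have lrC0 v : (lambda_root v)%:C != 0 by rewrite fmorph_eq0.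
have mr0 v : mu_root v != 0 by exact: (path_prod_neq0 treeE).
pose c u := (lambda_root u)%:C / mu_root u.
have c0 v : c v != 0 by rewrite mulf_neq0 ?invr_eq0.
(* [c v] is the inverse of the quotient whose squared modulus is [beta v]. *)
have cbeta v : Normc.normc (c v) ^+ 2 * beta v = 1.
  rewrite /beta -exprMn -Normc.normcM /c mulrA divfK// divff//.
  by rewrite Normc.normc1 expr1n.
have intertwine f :
    (fun v => c v * op_fun (wshift E root (@unit_weight R V) mu) f v)
    = op_fun (wshift E root beta (fun v => (lambda v)%:C)) (fun v => c v * f v).
  apply/funext => v /=; case: ifPn => [_|vroot]; first by rewrite mulr0.
  have lrE : lambda_root v = lambda v * lambda_root (par E v).
    exact: (path_prod_par treeE).
  have mrE : mu_root v = mu v * mu_root (par E v).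
    exact: (path_prod_par treeE).
  (* The factor [mu v] cancels, being nonzero off the root. *)
  rewrite /c lrE mrE rmorphM/=.
  by field; rewrite mr0 mu_neq0.
split.
- move=> v; rewrite exprn_gt0// lt_neqAle Normc_ge0 andbT eq_sym normc_eq0.
  by rewrite mulf_neq0 ?invr_eq0.
- exact: unitary_mul.
- split=> [|f _]; last exact: intertwine.
  (* Both domains amount to [f] and its shift by [mu] lying in l2 with unit weight: on the left the
     domain of [U] repeats the second condition, on the right [l2_mul] and [intertwine] translate
     the conditions for [beta]. *)
  apply/seteqP; split=> f /=.
    move=> [[f2 Sf2] _]; split=> //; split; first exact/(l2_mul cbeta).
    by rewrite -[X in l2 _ X]intertwine; apply/(l2_mul cbeta).
  move=> [f2 [_]]; rewrite -[X in l2 _ X]intertwine => /(l2_mul cbeta) Sf2.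
  by split.
Qed.
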